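(* Let $G$ be a connected graph of order $n$. (i) Let $t$ be a positive integer and $n\ge 4t^2+10t$. If $\lambda_1(D(G))\le \lambda_1\big(D(K_{2t-1}\vee(K_{n-2t}+K_1))\big)$, then $G$ is $t$-tough unless $G\cong K_{2t-1}\vee(K_{n-2t}+K_1)$. (ii) Let $t>0$ be such that $1/t$ is a positive integer, and let $n\ge 2t+\frac{9}{2t}+\frac92$. If $\lambda_1(D(G))\le \lambda_1\big(D(K_1\vee(K_{n-1-\frac1t}+\tfrac1t K_1))\big)$, then $G$ is $t$-tough unless $G\cong K_1\vee(K_{n-1-\frac1t}+\tfrac1t K_1)$.
   Context: All graphs are finite, simple and undirected. For a connected graph $G$, $D(G)$ is its distance matrix (entry $(i,j)$ = distance between $v_i$ and $v_j$), and $\lambda_1(D(G))$ its largest eigenvalue. $c(H)$ is the number of components of $H$. For $G\not\cong K_n$, the toughness is $\tau(G)=\min\{|S|/c(G-S): S\text{ a vertex cut of }G\}$, and $G$ is $t$-tough if $\tau(G)\ge t$. $K_m$ is the complete graph, $+$ denotes disjoint union, $sH$ is $s$ disjoint copies of $H$, and $G_1\vee G_2$ is the join (disjoint union plus all edges between the two parts). *)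

(* Defs.v *)
From HB Require Import structures.
From mathcomp Require Import all_boot all_order all_algebra.
From mathcomp Require Import reals.
Set Implicit Arguments. Unset Strict Implicit. Unset Printing Implicit Defensive.
Import Order.TTheory GRing.Theory Num.Theory.
Local Open Scope ring_scope.

Definition simple_graph (n : nat) (e : rel 'I_n) : Prop :=
  symmetric e /\ irreflexive e.

Definition connected_graph (n : nat) (e : rel 'I_n) : Prop :=
  forall x y, connect e x y.

Fixpoint ball (n : nat) (e : rel 'I_n) (k : nat) (x : 'I_n) : {set 'I_n} :=
  match k with
  | 0 => [set x]
  | k'.+1 => ball e k' x :|: [set z | [exists y in ball e k' x, e y z]]
  end.

(* graph distance: least k with y in ball k x (equals n if unreachable,
   which never happens for connected graphs) *)
Definition gdist (n : nat) (e : rel 'I_n) (x y : 'I_n) : nat :=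
  find (fun k => y \in ball e k x) (iota 0 n).

Definition distmx (R : realType) (n : nat) (e : rel 'I_n) : 'M[R]_n :=
  \matrix_(i, j) (gdist e i j)%:R.

Definition largest_eig (R : realType) (n : nat) (A : 'M[R]_n) (l : R) : Prop :=
  eigenvalue A l /\ (forall mu, eigenvalue A mu -> mu <= l).

Definition del_rel (n : nat) (e : rel 'I_n) (S : {set 'I_n}) : rel 'I_n :=
  fun x y => [&& x \notin S, y \notin S & e x y].

Definition ncomp (n : nat) (e : rel 'I_n) (S : {set 'I_n}) : nat :=
  n_comp (del_rel e S) (mem (~: S)).

Definition vertex_cut (n : nat) (e : rel 'I_n) (S : {set 'I_n}) : bool :=
  (1 < ncomp e S)%N.

(* t-tough: |S| / c(G-S) >= t for every vertex cut S (vacuous for K_n) *)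
Definition tough (R : realType) (t : R) (n : nat) (e : rel 'I_n) : Prop :=
  forall S : {set 'I_n}, vertex_cut e S -> t * (ncomp e S)%:R <= (#|S|)%:R.

Definition graph_iso (n : nat) (e1 e2 : rel 'I_n) : Prop :=
  exists f : 'I_n -> 'I_n, bijective f /\ forall x y, e2 (f x) (f y) = e1 x y.

(* K_a \vee (K_b + s K_1) with n = a + b + s: vertices [0,a) form K_a,
   [a,a+b) form K_b, the remaining s vertices are the isolated K_1's *)
Definition join_graph (n a b : nat) : rel 'I_n :=
  fun x y => (x != y) &&
    [|| (x < a)%N, (y < a)%N | [&& (a <= x)%N, (x < a + b)%N, (a <= y)%N & (y < a + b)%N]].
Arguments join_graph n a b : clear implicits.

(* Main.v *)
Require Import Defs.
From HB Require Import structures.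
From mathcomp Require Import all_boot all_order all_algebra.
From mathcomp Require Import reals.
From mathcomp Require Import complex.
From mathcomp Require Import ring lra zify.
Set Implicit Arguments.
Unset Strict Implicit.
Unset Printing Implicit Defensive.
Import Order.TTheory GRing.Theory Num.Theory.
Local Open Scope ring_scope.

(* Suppose that deleting S, with |S| = s, leaves c > s/t components. Replacing distances by their
   lower bounds 1 (adjacent) and 2 (non-adjacent), D(G) dominates J - I plus the adjacency matrix
   of the complete multipartite graph on the components of G - S. Let the target graph be
   H = K_q v (K_p + k K_1).
   If s <= q and c > k, evaluating the quadratic form of D(G) at a rearrangement of the Perron
   vector of H gives l1 > l2 unless G is isomorphic to H.
   Otherwise c is so large that the all-ones vector gives l1 >= n - 1 + x, where
   x n <= (c - 1)(2(n - s) - c) counts ordered non-adjacent pairs, while pairing the Perron vector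
   of H with the vector (1, 1 + b, 2) gives l2 < n - 1 + x. *)

(** * Rayleigh quotients of symmetric matrices and the Perron vector *)

Section Rayleigh.
Local Open Scope sesquilinear_scope.

(** The spectral theorem is applied over an algebraically closed field: the image of [M] there is
    Hermitian, hence unitarily diagonalizable. In the coordinates [w] of [y] both quadratic forms
    are diagonal, with entries [d 0 i] and 1, so it suffices that every [d 0 i] is at most
    [toC l]. *)
Lemma rayleigh_le_closure (R : realFieldType) (C : numClosedFieldType)
    (toC : {rmorphism R -> C}) (n : nat) (M : 'M[R]_n) (l : R) (y : 'rV[R]_n) :
  {mono toC : a b / a <= b} -> (forall z, z \is Num.real -> exists a, z = toC a) ->
  M^T = M -> (forall mu, eigenvalue M mu -> mu <= l) ->
  (y *m M *m y^T) 0 0 <= l * (y *m y^T) 0 0.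
Proof.
move=> le_toC real_toC symM lM.
pose A := map_mx toC M; pose Y := map_mx toC y.
have conj_toC (m1 m2 : nat) (B : 'M[R]_(m1, m2)) :
    map_mx Num.conj (map_mx toC B) = map_mx toC B.
  apply/matrixP=> i j; rewrite !mxE; apply/CrealP.
  by rewrite realE -(rmorph0 toC) !le_toC -realE num_real.
have hermA : A \is hermsymmx.
  by apply/is_hermitianmxP; rewrite expr0 scale1r map_trmx symM conj_toC.
set P := spectralmx A; set d := spectral_diag A.
have unitP : P \is unitarymx by exact: spectral_unitarymx.
have AE : A = P^t* *m diag_mx d *m P.
  by rewrite -invmx_unitary //; apply/orthomx_spectralP/hermitian_normalmx.
(* [d 0 i] is real, hence equal to some [toC r], and row [i] of [P] is an eigenvector for it. Since
   the characteristic polynomial is defined over [R], [r] is an eigenvalue of [M] itself. *)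
have d_le i : d 0 i <= toC l.
  have /mxOverP /(_ 0 i) /real_toC [r dr] := hermitian_spectral_diag_real hermA.
  rewrite -/d in dr *; rewrite dr le_toC; apply: lM.
  rewrite -(eigenvalue_map toC) -/A; apply/eigenvalueP; exists (row i P).
    have -> : row i P *m A = row i (diag_mx d *m P).
      by rewrite -row_mul AE !mulmxA (unitarymxP unitP) mul1mx.
    by apply/rowP => j; rewrite mul_diag_mx !mxE dr.
  apply/eqP => row0; have /unitarymxP /(congr1 (row i)) := unitP.
  rewrite row_mul row0 mul0mx => /rowP /(_ i); rewrite !mxE eqxx => /esym/eqP.
  by rewrite oner_eq0.
pose w := Y *m P^t*.
have w_form (e : 'rV[C]_n) :
    (w *m diag_mx e *m w^t*) 0 0 = \sum_i e 0 i * (w 0 i * (w 0 i)^*).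
  rewrite !mxE; apply: eq_bigr => i _; rewrite mul_mx_diag !mxE.
  by rewrite [_ * e 0 i]mulrC mulrA.
have wt : w^t* = P *m map_mx toC y^T.
  by rewrite /w trmx_mul map_mxM /= trmxCK /Y map_trmx conj_toC.
have formM : toC ((y *m M *m y^T) 0 0) = \sum_i d 0 i * (w 0 i * (w 0 i)^*).
  rewrite -w_form wt /w.
  have -> : toC ((y *m M *m y^T) 0 0) = map_mx toC (y *m M *m y^T) 0 0 by rewrite [RHS]mxE.
  by rewrite !map_mxM /= -/Y -/A AE !mulmxA.
have form1 : toC ((y *m y^T) 0 0) = \sum_i (w 0 i * (w 0 i)^*).
  under eq_bigr => i _ do rewrite -[w 0 i * _]mul1r.
  have -> : \sum_i 1 * (w 0 i * (w 0 i)^*) = (w *m diag_mx (const_mx 1) *m w^t*) 0 0.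
    by rewrite w_form; apply: eq_bigr => i _; rewrite [const_mx 1 0 i]mxE.
  rewrite wt diag_const_mx mulmx1 /w.
  have -> : toC ((y *m y^T) 0 0) = map_mx toC (y *m y^T) 0 0 by rewrite [RHS]mxE.
  rewrite map_mxM /= -/Y mulmxA -[_ *m P]mulmxA -invmx_unitary // mulVmx ?mulmx1 //.
  exact: unitarymx_unit.
rewrite -le_toC rmorphM /= formM form1 mulr_sumr; apply: ler_sum => i _.
by apply: ler_wpM2r (d_le i); exact: mul_conjC_ge0.
Qed.

End Rayleigh.

Lemma rayleigh_le (R : realType) (n : nat) (M : 'M[R]_n) (l : R) (y : 'rV[R]_n) :
  M^T = M -> (forall mu, eigenvalue M mu -> mu <= l) ->
  (y *m M *m y^T) 0 0 <= l * (y *m y^T) 0 0.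
Proof.
pose C : numClosedFieldType := R[i]%C.
pose toC : {rmorphism R -> C} := real_complex R.
have le_toC : {mono toC : a b / a <= b} by move=> a b; exact: lecR.
have real_toC (z : C) : z \is Num.real -> exists a, z = toC a.
  by move=> /complex_realP.
exact: (@rayleigh_le_closure _ C toC).
Qed.

Lemma rayleigh_sum (R : realType) (n : nat) (M : 'M[R]_n) (l : R) (x : 'I_n -> R) :
  M^T = M -> (forall mu, eigenvalue M mu -> mu <= l) ->
  \sum_i \sum_j M i j * (x i * x j) <= l * \sum_i x i ^+ 2.
Proof.
move=> symM lM; have := rayleigh_le (\row_i x i) symM lM.
congr (_ <= l * _).
  rewrite !mxE exchange_big; apply: eq_bigr => i _; rewrite !mxE big_distrl /=.
  by apply: eq_bigr => j _; rewrite !mxE; ring.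
by rewrite mxE; apply: eq_bigr => i _; rewrite !mxE expr2.
Qed.

(** First-order optimality: a positive slope [s] would beat the quadratic term [K] for small [e],
    and [e = s / K] already does. *)
Lemma nonneg_slope (R : realFieldType) (s K : R) :
  (forall e : R, 0 < e -> 2 * s <= e * K) -> s <= 0.
Proof.
move=> sK; have [//|s_gt0] := lerP s 0.
have K_gt0 : 0 < K by have := sK 1 ltr01; lra.
by have := sK (s / K) (divr_gt0 s_gt0 K_gt0); rewrite divfK ?gt_eqF //; lra.
Qed.

(* |v| attains the maximum of the Rayleigh quotient when v does; a maximizer x is an
   eigenvector, since moving from x along the residual Mx - lx cannot increase the quotient. *)
Lemma perron_vector (R : realType) (n : nat) (M : 'M[R]_n) (l : R) :
  M^T = M -> (forall i j, 0 <= M i j) -> (forall i j, i != j -> 0 < M i j) ->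
  largest_eig M l ->
  exists2 x : 'I_n -> R, (forall i, 0 < x i) & (forall i, \sum_j M i j * x j = l * x i).
Proof.
move=> symM M_ge0 M_gt0 [/eigenvalueP [v vM v0] lM].
have Msym i j : M i j = M j i by rewrite -[in LHS]symM mxE.
pose x i : R := `|v 0 i|.
have vE i : \sum_j M i j * v 0 j = l * v 0 i.
  have /rowP /(_ i) := vM; rewrite !mxE => <-.
  by apply: eq_bigr => j _; rewrite mulrC Msym.
have quad_x : \sum_i \sum_j M i j * (x i * x j) = l * \sum_i x i ^+ 2.
  apply/eqP; rewrite eq_le rayleigh_sum //=.
  have -> : l * \sum_i x i ^+ 2 = \sum_i \sum_j M i j * (v 0 i * v 0 j).
    rewrite mulr_sumr; apply: eq_bigr => i _.
    rewrite real_normK ?num_real // expr2 mulrA -vE mulr_suml.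
    by apply: eq_bigr => j _; ring.
  apply: ler_sum => i _; apply: ler_sum => j _.
  by apply: ler_wpM2l => //; rewrite -normrM ler_norm.
pose r i := \sum_j M i j * x j - l * x i.
have r0 i : r i = 0.
  have : \sum_i r i ^+ 2 <= 0.
    (* The Rayleigh inequality is expanded at [x + e r]. The terms without [e] cancel by [quad_x],
       the linear ones leave [2 e |r|^2], and one factor [e] is divided out. *)
    apply: (@nonneg_slope _ _ (l * \sum_i r i ^+ 2 - \sum_i \sum_j M i j * (r i * r j))) => e e_gt0.
    have := rayleigh_sum (fun i => x i + e * r i) symM lM.
    have -> : \sum_i \sum_j M i j * ((x i + e * r i) * (x j + e * r j)) =
        l * \sum_i x i ^+ 2 + 2 * e * \sum_i (r i * \sum_j M i j * x j)
        + e ^+ 2 * \sum_i \sum_j M i j * (r i * r j).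
      rewrite -quad_x.
      have -> : 2 * e * \sum_i (r i * \sum_j M i j * x j) =
          \sum_i \sum_j M i j * (e * (r i * x j)) + \sum_i \sum_j M i j * (e * (x i * r j)).
        rewrite mulrDl mul1r mulrDl; congr (_ + _); last rewrite exchange_big /=;
          rewrite mulr_sumr; apply: eq_bigr => k _; rewrite !mulr_sumr;
          apply: eq_bigr => j _; last rewrite Msym; ring.
      rewrite mulr_sumr -!big_split /=; apply: eq_bigr => k _.
      rewrite mulr_sumr -!big_split /=; apply: eq_bigr => j _; ring.
    have -> : \sum_i (x i + e * r i) ^+ 2 =
        \sum_i x i ^+ 2 + 2 * e * \sum_i r i * x i + e ^+ 2 * \sum_i r i ^+ 2.
      rewrite !mulr_sumr -!big_split /=; apply: eq_bigr => k _; ring.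
    have -> : \sum_i (r i * \sum_j M i j * x j) = \sum_i r i ^+ 2 + l * \sum_i r i * x i.
      rewrite mulr_sumr -big_split /=; apply: eq_bigr => k _.
      have -> : \sum_j M k j * x j = r k + l * x k by rewrite subrK.
      ring.
    move=> H; rewrite -(ler_pM2l e_gt0); lra.
  move=> r_le0; apply/eqP; rewrite -sqrf_eq0.
  have /psumr_eq0P : \sum_i r i ^+ 2 = 0.
    by apply/eqP; rewrite eq_le r_le0 sumr_ge0 // => k _; exact: sqr_ge0.
  by move=> -> // k _; exact: sqr_ge0.
have xE i : \sum_j M i j * x j = l * x i by apply/eqP; rewrite -subr_eq0 -/(r i) r0.
(* If [x i = 0], row [i] is a vanishing sum of nonnegative terms. As the off-diagonal entries are
   positive, all of [x], hence [v], would vanish. *)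
exists x => // i; rewrite lt0r normr_ge0 andbT.
apply/negP => /eqP xi0; move/eqP: v0; apply; apply/rowP => j; rewrite mxE.
have x_ge0 k : 0 <= x k by exact: normr_ge0.
have /eqP : M i j * x j = 0.
  have := xE i; rewrite xi0 mulr0 => /psumr_eq0P H.
  by apply: H => // k _; exact: mulr_ge0.
rewrite mulf_eq0; have [<- _|ij] := eqVneq i j.
  by apply/eqP; rewrite -normr_eq0; apply/eqP.
by rewrite gt_eqF ?M_gt0 //= normr_eq0 => /eqP.
Qed.

(** * Distances 0, 1 and 2, and the distance matrix of the join graph *)

Section Distances.
Variables (n : nat) (e : rel 'I_n).

(** [ball] extends walks at their far end; extending them at the start is what makes reversal of
    walks, and so symmetry of the distance, provable by induction. *)
Lemma ball_cons (k : nat) (x z y : 'I_n) :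
  e x z -> y \in ball e k z -> y \in ball e k.+1 x.
Proof.
move=> exz; elim: k y => [|k IHk] y.
  rewrite !inE => /eqP ->; apply/orP; right.
  by apply/existsP; exists x; rewrite inE eqxx.
rewrite in_setU inE => /orP[/IHk yk|/existsP[w /andP[/IHk wk ewy]]].
  by rewrite -[ball _ _ _]/(_ :|: _) in_setU yk.
rewrite -[ball _ _ _]/(_ :|: _) in_setU inE; apply/orP; right.
by apply/existsP; exists w; rewrite wk.
Qed.

Lemma ball_sym (k : nat) (x y : 'I_n) :
  symmetric e -> (y \in ball e k x) = (x \in ball e k y).
Proof.
move=> sym_e; suff sub u v : v \in ball e k u -> u \in ball e k v by apply/idP/idP; exact: sub.
elim: k v => [|k IHk] v; first by rewrite !inE eq_sym.
rewrite in_setU inE => /orP[/IHk uk|/existsP[w /andP[/IHk uw ewv]]].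
  by rewrite in_setU uk.
by apply: ball_cons uw; rewrite sym_e.
Qed.

Lemma gdist_sym (x y : 'I_n) : symmetric e -> gdist e x y = gdist e y x.
Proof. by move=> sym_e; apply: eq_find => k; rewrite ball_sym. Qed.

Lemma gdist_refl (x : 'I_n) : gdist e x x = 0%N.
Proof.
rewrite /gdist; case: n e x => [|m] f x; first by case: (x).
by rewrite /= inE eqxx.
Qed.

Lemma gdist_ge (x y : 'I_n) : x != y -> (1 + ~~ e x y <= gdist e x y)%N.
Proof.
rewrite /gdist; case: n e x y => [|[|m]] f x y; first by case: (x).
  by rewrite (ord1 x) (ord1 y) eqxx.
move=> xy; rewrite /= !inE eq_sym (negPf xy) /=.
case: existsP => [[w /andP[]]|nfxy]; first by rewrite inE => /eqP -> ->.
suff -> : ~~ f x y by [].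
by apply/negP => fxy; apply: nfxy; exists x; rewrite inE eqxx.
Qed.

Lemma gdist_adj (x y : 'I_n) : x != y -> e x y -> (gdist e x y <= 1)%N.
Proof.
rewrite /gdist; case: n e x y => [|[|m]] f x y; first by case: (x).
  by rewrite (ord1 x) (ord1 y) eqxx.
move=> xy fxy; rewrite /= !inE eq_sym (negPf xy) /=.
by case: existsP => // [[]]; exists x; rewrite inE eqxx.
Qed.

Lemma gdist_le2 (x y z : 'I_n) :
  x != y -> x != z -> z != y -> e x z -> e z y -> (gdist e x y <= 2)%N.
Proof.
move=> xy xz zy exz ezy.
(* [gdist] searches only radii below [n], so radius 2 must be shown to be among them. *)
have n_gt2 : (2 < n)%N.
  have /card_uniqP : uniq [:: x; y; z] by rewrite /= !inE negb_or xy xz eq_sym zy.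
  by move=> /= <-; rewrite -[X in (_ <= X)%N]card_ord max_card.
have y2 : y \in ball e 2 x.
  by apply: (ball_cons exz); apply: (ball_cons ezy); rewrite inE.
rewrite /gdist leqNgt; apply/negP => /(@before_find _ 0%N _ _ 2).
by rewrite nth_iota // y2.
Qed.

End Distances.

Lemma tr_distmx (R : realType) (n : nat) (e : rel 'I_n) :
  symmetric e -> (distmx R e)^T = distmx R e.
Proof. by move=> sym_e; apply/matrixP => i j; rewrite !mxE gdist_sym. Qed.

Lemma distmx_ge (R : realType) (n : nat) (e : rel 'I_n) (i j : 'I_n) :
  (i != j)%:R * (1 + (~~ e i j)%:R) <= distmx R e i j :> R.
Proof.
rewrite mxE; have [<-|ij] := eqVneq i j; first by rewrite gdist_refl mul0r.
by rewrite mul1r nat1r -add1n ler_nat gdist_ge.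
Qed.

Lemma join_graph_sym (n a b : nat) : symmetric (join_graph n a b).
Proof.
move=> x y; rewrite /join_graph eq_sym; congr (_ && _); lia.
Qed.

(** In the join graph the general lower bound is attained: vertex 0 lies in the dominating clique
    and is a common neighbour of any two non-adjacent vertices. *)
Lemma distmx_join (R : realType) (n a b : nat) (i j : 'I_n) : (0 < a <= n)%N ->
  distmx R (join_graph n a b) i j = (i != j)%:R * (1 + (~~ join_graph n a b i j)%:R).
Proof.
move=> /andP[a_gt0 a_le]; rewrite mxE; have [<-|ij] := eqVneq i j.
  by rewrite gdist_refl mul0r.
rewrite mul1r nat1r -add1n; congr (_%:R); apply/eqP; rewrite eqn_leq gdist_ge // andbT.
have [Hij|nHij] := boolP (join_graph n a b i j).
  exact: gdist_adj.
have n_gt0 : (0 < n)%N by lia.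
pose z := Ordinal n_gt0.
have [ia ja] : (a <= i)%N /\ (a <= j)%N.
  by move: nHij; rewrite /join_graph ij /=; lia.
have iz : i != z by apply/eqP => /(congr1 val) /=; lia.
have zj : z != j by apply/eqP => /(congr1 val) /=; lia.
apply: (gdist_le2 ij iz zj).
  by rewrite /join_graph iz /= a_gt0 orbT.
by rewrite /join_graph zj /= a_gt0.
Qed.

(** * The Perron vector of the target graph and bounds derived from it *)

Definition piecewise (R : Type) (q p : nat) (a b c : R) (i : nat) : R :=
  if (i < q)%N then a else if (i < q + p)%N then b else c.

Lemma sum_piecewise (R : realType) (q p k : nat) (a b c : R) :
  \sum_(i < q + p + k) piecewise q p a b c i = q%:R * a + p%:R * b + k%:R * c.
Proof.
rewrite !big_split_ord /= /piecewise; congr (_ + _ + _).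
- by rewrite (eq_bigr (fun=> a)) => [|i _]; rewrite ?ltn_ord // sumr_const card_ord mulr_natl.
- rewrite (eq_bigr (fun=> b)) => [|i _]; first by rewrite sumr_const card_ord mulr_natl.
  by rewrite ltn_add2l ltn_ord ltnNge leq_addr.
- rewrite (eq_bigr (fun=> c)) => [|i _]; first by rewrite sumr_const card_ord mulr_natl.
  by rewrite -addnA !ltnNge leq_addr addnA leq_addr.
Qed.

Lemma join_graphN (n q p : nat) (i j : 'I_n) : i != j ->
  ~~ join_graph n q p i j =
  [&& (q <= i)%N, (q <= j)%N & (q + p <= i)%N || (q + p <= j)%N].
Proof. by move=> ij; rewrite /join_graph ij /=; lia. Qed.

(** This is row [i] of D + I = J + (adjacency matrix of the complement), valid because the diameter
    is at most 2. *)
Lemma join_row_sum (R : realType) (n q p : nat) (x : 'I_n -> R) (i : 'I_n) :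
  (0 < q <= n)%N ->
  \sum_j distmx R (join_graph n q p) i j * x j + x i =
  \sum_j x j + \sum_j ((i != j) && ~~ join_graph n q p i j)%:R * x j.
Proof.
move=> q_bound; rewrite [X in X + _](bigD1 i) //= [X in _ = X + _](bigD1 i) //=.
rewrite [X in _ = _ + X](bigD1 i) //= distmx_join // eqxx !mul0r !add0r [LHS]addrC -[RHS]addrA.
congr (_ + _); rewrite -big_split /=; apply: eq_bigr => j ji.
by rewrite distmx_join // eq_sym ji mul1r mulrDl mul1r.
Qed.

(** Each row equation determines [x i] from the class sums alone, so the Perron vector is constant
    on each of the three classes. A vertex of the clique has no non-neighbour, one of K_p misses the
    isolated vertices, and an isolated vertex misses K_p and the other isolated vertices; adding its
    own entry turns the factor [l + 1] into [l + 2]. *)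
Lemma join_eigenvector (R : realType) (q p k : nat) (l : R) :
  (0 < q)%N -> (0 < p)%N -> (0 < k)%N ->
  largest_eig (distmx R (join_graph (q + p + k) q p)) l ->
  exists al be ga : R,
    let T := q%:R * al + p%:R * be + k%:R * ga in
    [/\ 0 < al, 0 < be & 0 < ga] /\
    [/\ (l + 1) * al = T, (l + 1) * be = T + k%:R * ga,
        (l + 2) * ga = T + p%:R * be + k%:R * ga &
        forall i : 'I_(q + p + k),
          \sum_j distmx R (join_graph (q + p + k) q p) i j * piecewise q p al be ga j =
          l * piecewise q p al be ga i].
Proof.
move=> q_gt0 p_gt0 k_gt0 l_max.
set n := (q + p + k)%N in l_max *; set H := join_graph n q p.
have q_bound : (0 < q <= n)%N by rewrite /n; lia.
have [||i j ij|x x_gt0 xE] := perron_vector _ _ _ l_max.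
- by apply: tr_distmx; exact: join_graph_sym.
- by move=> i j; rewrite mxE ler0n.
- by rewrite distmx_join // ij mul1r; case: (~~ _); rewrite ?addr0 ?ltr01 ?addr_gt0 ?ltr01.
pose T := \sum_j x j.
pose TB := \sum_(j : 'I_n) piecewise q p 0 (x j) 0 j.
pose TC := \sum_(j : 'I_n) piecewise q p 0 0 (x j) j.
have rowE i : (l + 1) * x i = T + \sum_j ((i != j) && ~~ H i j)%:R * x j.
  by rewrite -join_row_sum // xE mulrDl mul1r.
have rowA (i : 'I_n) : (i < q)%N -> (l + 1) * x i = T.
  move=> iq; rewrite rowE big1 ?addr0 // => j _.
  have [_|ij] := eqVneq i j; first by rewrite mul0r.
  by rewrite join_graphN //= leqNgt iq /= mul0r.
have rowB (i : 'I_n) : (q <= i < q + p)%N -> (l + 1) * x i = T + TC.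
  move=> iB; rewrite rowE; congr (_ + _); apply: eq_bigr => j _; rewrite /piecewise.
  have [<-|ij] := eqVneq i j.
    by rewrite mul0r; case: ltnP => //; case: ltnP => //; lia.
  rewrite join_graphN //=; case: (ltnP j q) => jq; case: (ltnP j (q + p)) => jp;
    (rewrite (_ : [&& _, _ & _] = true) ?mul1r //; lia) ||
    (rewrite (_ : [&& _, _ & _] = false) ?mul0r //; lia) || lia.
have rowC (i : 'I_n) : (q + p <= i)%N -> (l + 2) * x i = T + TB + TC.
  move=> iC; have -> : (l + 2) * x i = (l + 1) * x i + x i by ring.
  rewrite rowE -!addrA; congr (_ + _).
  have -> : x i = \sum_j (i == j)%:R * x j.
    rewrite (bigD1 i) //= eqxx mul1r big1 ?addr0 // => j ji.
    by rewrite eq_sym (negPf ji) mul0r.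
  rewrite -!big_split /=; apply: eq_bigr => j _; rewrite /piecewise.
  have [<-|ij] := eqVneq i j.
    by rewrite mul0r mul1r !ifN ?add0r //; lia.
  rewrite join_graphN //= mul0r addr0; case: (ltnP j q) => jq; case: (ltnP j (q + p)) => jp;
    (rewrite (_ : [&& _, _ & _] = true) ?mul1r ?addr0 ?add0r //; lia) ||
    (rewrite (_ : [&& _, _ & _] = false) ?mul0r ?addr0 //; lia) || lia.
have n_gt0 : (0 < n)%N by lia.
have T_gt0 : 0 < T.
  rewrite /T (bigD1 (Ordinal n_gt0)) //= ltr_wpDr // sumr_ge0 // => j _; exact: ltW.
(* Vertex 0 belongs to the clique since [q] is positive, so its row reads [(l + 1) * x 0 = T]. *)
have l1_gt0 : 0 < l + 1.
  by rewrite -(pmulr_lgt0 _ (x_gt0 (Ordinal n_gt0))) rowA.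
have TB_ge0 : 0 <= TB.
  by apply: sumr_ge0 => j _; rewrite /piecewise; case: ifP => // _; case: ifP => // _; exact: ltW.
have TC_ge0 : 0 <= TC.
  by apply: sumr_ge0 => j _; rewrite /piecewise; case: ifP => // _; case: ifP => // _; exact: ltW.
have l2_gt0 : 0 < l + 2 by lra.
pose al := T / (l + 1); pose be := (T + TC) / (l + 1); pose ga := (T + TB + TC) / (l + 2).
have xP i : x i = piecewise q p al be ga i.
  rewrite /piecewise; case: ltnP => iq.
    by apply: (mulfI (lt0r_neq0 l1_gt0)); rewrite rowA // mulrC divfK ?gt_eqF.
  case: ltnP => ip.
    by apply: (mulfI (lt0r_neq0 l1_gt0)); rewrite rowB ?iq // mulrC divfK ?gt_eqF.
  by apply: (mulfI (lt0r_neq0 l2_gt0)); rewrite rowC // mulrC divfK ?gt_eqF.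
have TE : T = q%:R * al + p%:R * be + k%:R * ga.
  by rewrite -sum_piecewise; apply: eq_bigr => j _.
have TBE : TB = p%:R * be.
  transitivity (q%:R * 0 + p%:R * be + k%:R * 0); last by ring.
  rewrite -sum_piecewise; apply: eq_bigr => j _.
  by rewrite /piecewise xP /piecewise; case: ltnP => //; case: ltnP.
have TCE : TC = k%:R * ga.
  transitivity (q%:R * 0 + p%:R * 0 + k%:R * ga); last by ring.
  rewrite -sum_piecewise; apply: eq_bigr => j _.
  by rewrite /piecewise xP /piecewise; case: ltnP => //; case: ltnP.
exists al, be, ga; split; first by split; apply: divr_gt0 => //; lra.
rewrite /= -TE -TCE -TBE; split; try by rewrite mulrC divfK ?gt_eqF.
by move=> i; rewrite -xP -xE; apply: eq_bigr => j _; rewrite xP.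
Qed.

(* Pairing the eigenvector equations with the test vector (1, 1 + b, 2). *)
Lemma join_eig_upper (R : realFieldType) (q p k b x mu al be ga : R) :
  0 < q -> 0 < p -> 0 < k -> 0 <= b -> 0 < al -> 0 < be -> 0 < ga ->
  mu * al = q * al + p * be + k * ga ->
  mu * be = q * al + p * be + k * ga + k * ga ->
  (mu + 1) * ga = q * al + p * be + k * ga + p * be + k * ga ->
  p * b + k < x -> 3 * k < x + (q + k + x) * b ->
  mu < q + p + k + x.
Proof.
move=> q0 p0 k0 b0 al0 be0 ga0 Eal Ebe Ega xb1 xb2.
pose W := q * al + p * (1 + b) * be + 2 * k * ga.
have W0 : 0 < W by rewrite /W !addr_gt0 ?mulr_gt0 //; lra.
rewrite -(ltr_pM2r W0).
have -> : mu * W = q * al * (q + p * (1 + b) + 2 * k) +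
    p * be * (q + p * (1 + b) + 4 * k) +
    k * ga * (q + 2 * p * (1 + b) + 4 * k - 2).
  transitivity (q * (mu * al) + p * (1 + b) * (mu * be) + 2 * k * ((mu + 1) * ga - ga)).
    rewrite /W; ring.
  rewrite Eal Ebe Ega; ring.
have -> : (q + p + k + x) * W = q * al * (q + p + k + x) +
    p * be * ((q + p + k + x) * (1 + b)) + k * ga * (2 * (q + p + k + x)).
  rewrite /W; ring.
(* The comparison is made coefficient by coefficient. For [al] and [be] it is exactly the first and
   the second hypothesis on [x] and [b]; for [ga] it follows from the first. *)
rewrite !ltrD // ltr_pM2l ?mulr_gt0 //; nra.
Qed.

(** Subtracting the equations gives [(mu + 1) * ga = (mu + p) * be], and [p < mu]. The factor 2 is
    what lets two vertices of the largest component outweigh one lost pair in the comparison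
    below. *)
Lemma join_eig_ratio (R : realFieldType) (q p k mu al be ga : R) :
  0 < q -> 0 < p -> 0 < k -> 0 < al -> 0 < be -> 0 < ga ->
  mu * be = q * al + p * be + k * ga + k * ga ->
  (mu + 1) * ga = q * al + p * be + k * ga + p * be + k * ga ->
  ga < 2 * be.
Proof.
move=> q0 p0 k0 al0 be0 ga0 Ebe Ega.
have pmu : p < mu.
  by rewrite -(ltr_pM2r be0) Ebe; have := mulr_gt0 q0 al0; have := mulr_gt0 k0 ga0; lra.
have : (mu + 1) * ga = (mu + p) * be by rewrite Ega mulrDl Ebe; ring.
by move=> E; rewrite -(ltr_pM2l (_ : 0 < mu + 1)); [rewrite E; nra|lra].
Qed.

(** * Choosing vertex sets and representatives of labels *)

Lemma exists_subset_card (T : finType) (A : {set T}) (m : nat) :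
  (m <= #|A|)%N -> exists2 B : {set T}, B \subset A & #|B| = m.
Proof.
move=> mA; exists [set x in take m (enum A)].
  by apply/subsetP => x; rewrite inE => /mem_take; rewrite mem_enum.
rewrite cardsE (card_uniqP (take_uniq m (enum_uniq A))) size_take -cardE.
by case: ltngtP mA.
Qed.

(** On [A] the representative [r x] depends only on the label [f x], so the fixed points of [r] in
    [A] contain exactly one vertex for each label. The default of [odflt] is never reached for [x]
    in [A]. *)
Lemma exists_transversal (T U : finType) (f : T -> U) (A : {set T}) :
  exists B : {set T}, [/\ B \subset A, {in B &, injective f} & f @: B = f @: A].
Proof.
pose r x := odflt x [pick y in A | f y == f x].
have rP x : x \in A -> r x \in A /\ f (r x) = f x.
  move=> xA; rewrite /r; case: pickP => [y /andP[yA /eqP fyx] //|/(_ x)].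
  by rewrite xA eqxx.
have rr x y : x \in A -> y \in A -> f x = f y -> r x = r y.
  move=> xA yA fxy; rewrite /r -fxy; case: pickP => // /(_ x).
  by rewrite xA eqxx.
pose B := [set x in A | r x == x].
have BA : B \subset A by apply/subsetP => x; rewrite inE => /andP[].
exists B; split => //.
  move=> x y; rewrite !inE => /andP[xA /eqP rx] /andP[yA /eqP ry] fxy.
  by rewrite -rx -ry; exact: rr.
apply/eqP; rewrite eqEsubset imsetS //=; apply/subsetP => _ /imsetP[x xA ->].
have [rxA frx] := rP x xA.
by apply/imsetP; exists (r x); rewrite ?frx // inE rxA (rr (r x) x) /=.
Qed.

(** The vertices added to [S] are taken outside a set of [m] representatives with distinct labels,
    so these labels survive. *)
Lemma enlarge_keep_labels (n m q : nat) (U : finType) (f : 'I_n -> U) (S : {set 'I_n}) :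
  (#|S| <= q)%N -> (q + m <= n)%N -> (m <= #|f @: ~: S|)%N ->
  exists S' : {set 'I_n}, [/\ S \subset S', #|S'| = q & (m <= #|f @: ~: S'|)%N].
Proof.
move=> Sq qmn mf; have [B [BS injB fB]] := exists_transversal f (~: S).
rewrite -fB (card_in_imset injB) in mf.
have [B' B'B cardB'] := exists_subset_card mf.
have B'S : B' \subset ~: S by exact: subset_trans BS.
have cardS := cardsC S; rewrite card_ord in cardS.
have [] := @exists_subset_card _ (~: S :\: B') (q - #|S|).
  by rewrite cardsDS // cardB'; lia.
move=> E; rewrite subsetD => /andP[ES EB'] cardE'.
exists (S :|: E); split; first exact: subsetUl.
  have SE : [disjoint S & E] by rewrite disjoint_sym -[S]setCK disjoints_subset ?setCK.
  by rewrite cardsU (disjoint_setI0 SE) cards0; lia.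
have : f @: B' \subset f @: ~: (S :|: E).
  apply: imsetS; rewrite setCU subsetI B'S -disjoints_subset disjoint_sym.
  exact: EB'.
move=> /subset_leq_card; apply: leq_trans.
by rewrite card_in_imset ?cardB' //; exact: (sub_in2 (subsetP B'B)).
Qed.

(** The vertices are listed as [S], then the rest, then [C], and each is sent to its position in the
    list. *)
Lemma exists_class_bijection (q p k : nat) (S C : {set 'I_(q + p + k)}) :
  [disjoint S & C] -> #|S| = q -> #|C| = k ->
  exists2 s : 'I_(q + p + k) -> 'I_(q + p + k), bijective s &
    forall u, (u \in S) = (s u < q)%N /\ (u \in C) = (q + p <= s u)%N.
Proof.
move=> dSC cardS cardC; pose B := ~: (S :|: C).
have cardB : #|B| = p.
  have := cardsC (S :|: C); rewrite card_ord cardsU (disjoint_setI0 dSC) cards0.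
  by rewrite cardS cardC -/B; lia.
pose r := enum S ++ enum B ++ enum C.
have r_all u : u \in r.
  rewrite !mem_cat !mem_enum /B !inE.
  by case: (u \in S); case: (u \in C).
have size_r : size r = (q + p + k)%N.
  by rewrite !size_cat -!cardE cardS cardB cardC addnA.
have lt_r u : (index u r < q + p + k)%N by rewrite -[X in (_ < X)%N]size_r index_mem.
pose s u := Ordinal (lt_r u).
exists s.
  apply: injF_bij => u v /(congr1 val) /= /(congr1 (nth u r)).
  by rewrite !nth_index.
move=> u; rewrite /s /= /r !index_cat !mem_enum -!cardE cardS cardB.
have index_lt (A : {set 'I_(q + p + k)}) : u \in A -> (index u (enum A) < #|A|)%N.
  by move=> uA; rewrite cardE index_mem mem_enum.
case: ifPn => uS.
  have := index_lt _ uS; rewrite cardS => lt_q; rewrite lt_q; split=> //.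
  rewrite leqNgt (leq_trans lt_q) ?leq_addr //.
  by rewrite (disjointFr dSC uS).
case: ifPn => uB.
  have := index_lt _ uB; rewrite cardB => lt_p.
  have /negbTE -> : u \notin C by move: uB; rewrite /B !inE negb_or => /andP[].
  by split; apply/esym/negbTE; lia.
have uC : u \in C by move: uB; rewrite /B !inE negb_or uS negbK.
by rewrite uC; split; [apply/esym/negbTE|apply/esym]; lia.
Qed.

(** With more than [k] labels, dropping the label [a] of a largest class still leaves [k] others to
    represent. *)
Lemma exists_reps_off_largest (T U : finType) (f : T -> U) (X : {set T}) (k : nat) :
  (k < #|f @: X|)%N ->
  exists (C : {set T}) (a : U),
    [/\ C \subset X, #|C| = k, {in C &, injective f}, a \notin f @: C &
        forall u, u \in X -> (#|[set v in X | f v == f u]| <= #|[set v in X | f v == a]|)%N].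
Proof.
move=> kf; have [u0 u0X] : exists u, u \in X.
  apply/set0Pn; apply: contraTneq kf => ->; by rewrite imset0 cards0.
have [/= w wX w_max] := @arg_maxnP _ u0 (mem X) (fun u => #|[set v in X | f v == f u]|) u0X.
have [B [BX injB fB]] := exists_transversal f X.
pose B' := [set x in B | f x != f w].
have B'B : B' \subset B by apply/subsetP => x; rewrite inE => /andP[].
have [|C CB' cardC] := @exists_subset_card _ B' k.
  have injB' : {in B' &, injective f} by apply: sub_in2 injB; exact/subsetP.
  have := cardsD1 (f w) (f @: X); rewrite (imset_f f wX) => cardX.
  have /subset_leq_card : (f @: X) :\ f w \subset f @: B'.
    apply/subsetP => a; rewrite -fB !inE => /andP[aw /imsetP[x xB ax]].
    by apply/imsetP; exists x; rewrite // inE xB -ax.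
  by rewrite (card_in_imset injB'); lia.
have CB := subset_trans CB' B'B.
exists C, (f w); split=> //.
- exact: subset_trans BX.
- by apply: sub_in2 injB; exact/subsetP.
- apply/imsetP => [[x xC fwx]].
  by have /(subsetP CB') := xC; rewrite inE fwx eqxx andbF.
Qed.

(** * Comparison with the target graph when at most [q] vertices are removed *)

Section Comparison.
Variables (R : realType) (q p k : nat) (e : rel 'I_(q + p + k)).
Variables (S : {set 'I_(q + p + k)}) (f : 'I_(q + p + k) -> 'I_(q + p + k)) (l1 l2 : R).
Local Notation H := (join_graph (q + p + k) q p).

(* The eigenvector of H is transported along a bijection that puts S on the dominating clique
   and one vertex of each of k components, none of them the largest component L, on the
   isolated vertices. Each vertex u of P (sharing a component with such a representative)
   loses one weighted pair [be * ga] and gains at least [be ^+ 2] for each vertex of L. *)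
Lemma join_graph_minimal :
  (0 < q)%N -> (0 < p)%N -> (0 < k)%N -> simple_graph e -> #|S| = q ->
  (forall u v, u \notin S -> v \notin S -> e u v -> f u = f v) ->
  (k < #|f @: ~: S|)%N ->
  (forall mu, eigenvalue (distmx R e) mu -> mu <= l1) -> largest_eig (distmx R H) l2 ->
  l1 <= l2 -> graph_iso e H.
Proof.
move=> q_gt0 p_gt0 k_gt0 [sym_e irr_e] cardS sep kf l1_max l2_max l12.
have [al [be [ga [[al0 be0 ga0] [_ Ebe Ega eigH]]]]] := join_eigenvector q_gt0 p_gt0 k_gt0 l2_max.
have ratio : ga < 2 * be.
  apply: (@join_eig_ratio _ q%:R p%:R k%:R (l2 + 1) al be ga); rewrite ?ltr0n //.
  by rewrite -addrA.
have [C [a [CS cardC injC aC a_max]]] := exists_reps_off_largest kf.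
have dSC : [disjoint S & C].
  by rewrite disjoint_sym disjoints_subset.
have [s s_bij sP] := exists_class_bijection dSC cardS cardC.
pose y u := piecewise q p al be ga (s u).
have yE u : y u = if u \in S then al else if u \in C then ga else be.
  by rewrite /y /piecewise; have [-> ->] := sP u; case: ifP => // _; rewrite ltnNge; case: leqP.
have y_gt0 u : 0 < y u by rewrite yE; case: ifP => // _; case: ifP.
(* A lower bound for the difference of corresponding entries of the two distance matrices: it is 1
   for an edge of H missing in G and -1 for an edge of G missing in H. *)
pose diff u v : R := (u != v)%:R * ((~~ e u v)%:R - (~~ H (s u) (s v))%:R).
have s_inj := bij_inj s_bij.
have diff_le0 : \sum_u \sum_v diff u v * (y u * y v) <= 0.
  have quadH : \sum_u \sum_v distmx R H (s u) (s v) * (y u * y v) = l2 * \sum_u y u ^+ 2.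
    rewrite mulr_sumr; apply: eq_bigr => u _.
    rewrite expr2 mulrA -eigH [in RHS](reindex s) /=; last exact: onW_bij.
    by rewrite mulr_suml; apply: eq_bigr => v _; rewrite -/(y u) -/(y v); ring.
  have quadG : \sum_u \sum_v distmx R e u v * (y u * y v) <= l2 * \sum_u y u ^+ 2.
    apply: le_trans (rayleigh_sum _ (tr_distmx _ sym_e) l1_max) _.
    by apply: ler_wpM2r l12; apply: sumr_ge0 => u _; exact: sqr_ge0.
  apply: le_trans (_ : \sum_u \sum_v (distmx R e u v - distmx R H (s u) (s v)) * (y u * y v) <= 0).
    apply: ler_sum => u _; apply: ler_sum => v _.
    rewrite ler_pM2r ?mulr_gt0 // distmx_join; last lia.
    rewrite (inj_eq s_inj) /diff; apply: le_trans (lerB (distmx_ge _ _ _ _) (lexx _)).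
    by rewrite -mulrBr ler_wpM2l ?ler0n //; lra.
  under eq_bigr => u _ do under eq_bigr => v _ do rewrite mulrBl.
  under eq_bigr => u _ do rewrite sumrB.
  by rewrite sumrB quadH subr_le0.
pose P u := [&& u \notin S, u \notin C & f u \in f @: C].
pose L w := (w \notin S) && (f w == a).
(* Together with their reversals, these are the only pairs where [diff] can be negative: a
   representative and another vertex of its component. *)
pose X u v := [&& u \in C, P v & f u == f v].
have LC w : L w -> w \notin C.
  by move=> /andP[_ /eqP fw]; apply: contra aC => wC; rewrite -fw imset_f.
have CnS u : u \in C -> u \notin S by move=> /(subsetP CS); rewrite inE.
have HE u v : u != v -> ~~ H (s u) (s v) =
    [&& u \notin S, v \notin S & (u \in C) || (v \in C)].
  move=> uv; rewrite join_graphN ?(inj_eq s_inj) //.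
  by have [-> ->] := sP u; have [-> ->] := sP v; rewrite -!leqNgt.
have nadj u v : u \notin S -> v \notin S -> f u != f v -> ~~ e u v.
  by move=> uS vS; apply: contra => /(sep _ _ uS vS) ->.
have PL u : P u -> L u = false.
  move=> /and3P[_ _ fu]; apply/negbTE; apply: contraL fu => /andP[_ /eqP ->].
  exact: aC.
have diff_ge u v : be ^+ 2 * ((P u)%:R * (L v)%:R + (L u)%:R * (P v)%:R)
    - be * ga * ((X u v)%:R + (X v u)%:R) <= diff u v * (y u * y v).
  have be2 : 0 <= be ^+ 2 := sqr_ge0 be.
  have bega : 0 < be * ga by exact: mulr_gt0.
  have [<-|uv] := eqVneq u v.
    have -> : X u u = false by rewrite /X /P; case: (u \in C); rewrite ?andbF.
    rewrite /diff eqxx !mul0r [(L u)%:R * _]mulrC -natrM mulnb.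
    have -> : P u && L u = false by apply/negP => /andP[/PL ->].
    by rewrite !(addr0, mulr0, subr0).
  rewrite /diff uv mul1r HE // /X.
  have [uS|uS] := boolP (u \in S).
    have -> : P u = false by rewrite /P uS.
    have -> : L u = false by rewrite /L uS.
    have /negbTE -> : u \notin C by apply: contraL uS; exact: CnS.
    by rewrite /= andbF !(mul0r, addr0, mulr0, subr0) mulr_ge0 ?ler0n // ltW ?mulr_gt0.
  have [vS|vS] := boolP (v \in S).
    have -> : P v = false by rewrite /P vS.
    have -> : L v = false by rewrite /L vS.
    have /negbTE -> : v \notin C by apply: contraL vS; exact: CnS.
    by rewrite /= andbF !(mul0r, addr0, mulr0, subr0) mulr_ge0 ?ler0n // ltW ?mulr_gt0.
  have [uC|uC] := boolP (u \in C).
    have -> : P u = false by rewrite /P uC andbF.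
    have /negbTE -> : ~~ L u by apply: contraL uC; exact: LC.
    rewrite !yE (negPf uS) (negPf vS) uC /= andbF !(mul0r, addr0, mulr0).
    have [vC|vC] := boolP (v \in C).
      have -> : P v = false by rewrite /P vC andbF.
      have -> : ~~ e u v by apply: nadj => //; apply: contraNneq uv => /injC -> //.
      by rewrite /= !(mulr0, subrr, mul0r).
    have [fuv|fuv] := eqVneq (f u) (f v).
      have -> : P v by rewrite /P vS vC -fuv imset_f.
      by have := mulr_ge0 (ler0n R (~~ e u v)) (ltW bega); rewrite /= [ga * _]mulrC; lra.
    by rewrite nadj // andbF !(mulr0, subrr, mul0r).
  have [vC|vC] := boolP (v \in C).
    have -> : P v = false by rewrite /P vC andbF.
    have /negbTE -> : ~~ L v by apply: contraL vC; exact: LC.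
    rewrite !yE (negPf uS) (negPf vS) (negPf uC) vC /= !(mul0r, addr0, mulr0, add0r).
    have [fuv|fuv] := eqVneq (f v) (f u).
      have -> : P u by rewrite /P uS uC -fuv imset_f.
      by have := mulr_ge0 (ler0n R (~~ e u v)) (ltW bega); rewrite /=; lra.
    have -> : ~~ e u v by apply: nadj; rewrite // eq_sym.
    by rewrite andbF !(mulr0, subrr, mul0r, oppr0).
  rewrite !yE (negPf uS) (negPf vS) (negPf uC) (negPf vC) /= addr0 mulr0 !subr0 -expr2 mulrC.
  rewrite ler_wpM2r // -!natrM -natrD ler_nat.
  have fPL x z : P x -> L z -> f x != f z.
    move=> /and3P[_ _ fx] /andP[_ /eqP ->]; by apply: contraNneq aC => <-.
  case Pu: (P u); first rewrite (PL _ Pu) /=.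
    by case Lv: (L v) => //; rewrite nadj // fPL.
  case Lu: (L u) => //; case Pv: (P v) => //.
  by rewrite (PL _ Pv) nadj // eq_sym fPL.
pose nP : R := \sum_u (P u)%:R; pose nL : R := \sum_u (L u)%:R.
have sumX : \sum_u \sum_v (X u v)%:R <= nP.
  (* Each vertex of [P] shares its label with only one representative, by injectivity of [f] on
     [C]. *)
  rewrite exchange_big; apply: ler_sum => v _; rewrite /X.
  case Pv: (P v); last by rewrite big1 // => u _; rewrite andbF.
  have /and3P[_ _ /imsetP[c cC fvc]] := Pv.
  rewrite (bigD1 c) //= big1 ?addr0; first by case: (_ && _).
  move=> u uc; case uC: (u \in C) => //=; rewrite fvc.
  by case: eqP => // /(injC _ _ uC cC) /eqP; rewrite (negPf uc).
have total : 2 * be * (nP * (be * nL - ga)) <= 0.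
  apply: le_trans diff_le0.
  apply: le_trans (_ : \sum_u \sum_v (be ^+ 2 * ((P u)%:R * (L v)%:R + (L u)%:R * (P v)%:R)
    - be * ga * ((X u v)%:R + (X v u)%:R)) <= _); last first.
    by apply: ler_sum => u _; apply: ler_sum => v _.
  have -> : \sum_u \sum_v (be ^+ 2 * ((P u)%:R * (L v)%:R + (L u)%:R * (P v)%:R)
      - be * ga * ((X u v)%:R + (X v u)%:R)) =
      be ^+ 2 * (\sum_u \sum_v (P u)%:R * (L v)%:R + \sum_u \sum_v (L u)%:R * (P v)%:R)
      - be * ga * (\sum_u \sum_v (X u v)%:R + \sum_u \sum_v (X v u)%:R).
    rewrite -!big_split /= !mulr_sumr -sumrB; apply: eq_bigr => u _.
    by rewrite -!big_split /= !mulr_sumr -sumrB.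
  rewrite -!big_distrlr /= -/nP -/nL [\sum_u \sum_v (X v u)%:R]exchange_big /=.
  have := ler_wpM2l (ltW (mulr_gt0 be0 ga0)) sumX; lra.
(* If [P] is nonempty, some component has two vertices, [u] and its representative [c], so the
   largest one does too. Then [be * nL >= 2 * be > ga] contradicts [total]. *)
have [u Pu|P0] := pickP P.
  have nP_gt0 : 0 < nP.
    by rewrite /nP (bigD1 u) //= Pu ltr_pwDl ?ltr01 // sumr_ge0.
  have nL_ge2 : 2 <= nL.
    have -> : nL = #|[set v in ~: S | f v == a]|%:R.
      rewrite -sum1dep_card natr_sum big_mkcond; apply: eq_bigr => v _.
      by rewrite /L inE; case: (_ && _).
    have /and3P[uS uC /imsetP[c cC fuc]] := Pu.
    rewrite ler_nat; apply: leq_trans (a_max u _); last by rewrite inE.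
    have two : #|[set u; c]| = 2.
      by rewrite cards2; case: eqP uC => // ->; rewrite cC.
    rewrite -[leqLHS]two; apply: subset_leq_card; apply/subsetP => v; rewrite !inE => /orP[] /eqP ->.
      by rewrite uS eqxx.
    by rewrite (CnS _ cC) fuc eqxx.
  have : 0 < 2 * be * (nP * (be * nL - ga)) by rewrite !mulr_gt0 //; nra.
  by rewrite ltNge total.
(* With [P] empty no pair is lost; nonnegative terms with a nonpositive sum all vanish, so adjacency
   agrees under [s]. *)
have dyy_ge0 u v : 0 <= diff u v * (y u * y v).
  apply: le_trans (diff_ge u v).
  have -> : X u v = false by rewrite /X P0 andbF.
  have -> : X v u = false by rewrite /X P0 andbF.
  by rewrite !P0 /= !(mul0r, mulr0, addr0, subr0).
exists s; split=> // u v; have [<-|uv] := eqVneq u v.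
  by rewrite irr_e /join_graph eqxx.
have : diff u v * (y u * y v) = 0.
  have row_ge0 w : 0 <= \sum_v diff w v * (y w * y v) by exact: sumr_ge0.
  have sum0 : \sum_u \sum_v diff u v * (y u * y v) = 0.
    by apply/eqP; rewrite eq_le diff_le0 sumr_ge0.
  have row0 : \sum_v diff u v * (y u * y v) = 0.
    exact: (psumr_eq0P (fun w _ => row_ge0 w) sum0).
  exact: (psumr_eq0P (fun w _ => dyy_ge0 u w) row0).
move/eqP; rewrite /diff uv mul1r mulf_eq0 [y u * y v == 0]gt_eqF ?mulr_gt0 // orbF.
by rewrite subr_eq0 eqr_nat; case: (e u v); case: (H _ _).
Qed.
End Comparison.

(** * Lower bound on the eigenvalue from the number of components *)

(** The sum is [m^2] minus the sum of the squared class sizes. Every size N lies between 1 and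
    [m - c + 1], so (N - 1)(N - (m - c + 1)) <= 0 bounds its square linearly, and the sizes add up
    to [m]. Equality holds for one big class and singletons. *)
Lemma sum_pair_class (R : realDomainType) (T U : finType) (f : T -> U) (A : {set T}) :
  (#|f @: A|%:R - 1) * (2 * #|A|%:R - #|f @: A|%:R) <=
  \sum_u \sum_v [&& u \in A, v \in A & f u != f v]%:R :> R.
Proof.
set c : R := #|_|%:R; set m : R := #|A|%:R.
pose N a : R := \sum_(v in A | f v == a) 1.
have mE : m = \sum_(a in f @: A) N a.
  by rewrite /m -sum1_card natr_sum (partition_big_imset f).
have N_ge1 a : a \in f @: A -> 1 <= N a.
  by case/imsetP => u uA ->; rewrite /N (bigD1 u) ?uA ?eqxx //= lerDl sumr_ge0.
have N_le a : a \in f @: A -> N a <= m - c + 1.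
  move=> aA; rewrite mE (bigD1 a) //=.
  have : c - 1 <= \sum_(b in f @: A | b != a) N b.
    have -> : c - 1 = \sum_(b in f @: A | b != a) (1 : R).
      rewrite /c -sum1_card natr_sum (bigD1 a) //=.
      by rewrite addrAC subrr add0r.
    by apply: ler_sum => b /andP[/N_ge1].
  by lra.
have -> : \sum_u \sum_v [&& u \in A, v \in A & f u != f v]%:R = m ^+ 2 - \sum_(a in f @: A) N a ^+ 2 :> R.
  have sumA (u : T) : u \in A ->
      \sum_v [&& u \in A, v \in A & f u != f v]%:R = m - N (f u) :> R.
    move=> uA; rewrite /m /N -sum1_card natr_sum.
    rewrite [X in X - _]big_mkcond [X in _ - X]big_mkcond -sumrB; apply: eq_bigr => v _; rewrite uA eq_sym /=.
    by case: (v \in A); case: (f v == f u); rewrite /= ?subrr ?subr0.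
  transitivity (\sum_(u in A) (m - N (f u))).
    rewrite [RHS]big_mkcond; apply: eq_bigr => u _; case: ifPn => uA.
      by rewrite -sumA // uA.
    by rewrite big1.
  rewrite sumrB sumr_const -[m *+ _]mulr_natr -/m -expr2; congr (_ - _).
  rewrite (partition_big_imset f); apply: eq_bigr => a _.
  rewrite expr2 /N [RHS]mulr_suml; apply: eq_bigr => u /andP[_ /eqP ->].
  by rewrite mul1r.
have : \sum_(a in f @: A) N a ^+ 2 <= \sum_(a in f @: A) ((m - c + 2) * N a - (m - c + 1)).
  by apply: ler_sum => a aA; have := N_ge1 a aA; have := N_le a aA; nra.
rewrite sumrB -mulr_sumr -mE sumr_const -[_ *+ #|_|]mulr_natr -/c.
by lra.
Qed.

(** The all-ones vector gives [l * n] at least the sum of all distances; each ordered pair of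
    distinct vertices contributes 1, and each pair with different labels at least 1 more. *)
Lemma distmx_eig_lower (R : realType) (n : nat) (e : rel 'I_n) (S : {set 'I_n})
    (U : finType) (f : 'I_n -> U) (l : R) :
  symmetric e -> (forall u v, u \notin S -> v \notin S -> e u v -> f u = f v) ->
  (forall mu, eigenvalue (distmx R e) mu -> mu <= l) ->
  n%:R * (n%:R - 1) + (#|f @: ~: S|%:R - 1) * (2 * (n%:R - #|S|%:R) - #|f @: ~: S|%:R) <=
  l * n%:R.
Proof.
move=> sym_e sep l_max; set c : R := #|f @: _|%:R; set m := _ - #|S|%:R.
have := rayleigh_sum (fun=> 1) (tr_distmx R sym_e) l_max.
under [X in _ <= _ * X]eq_bigr do rewrite expr1n.
rewrite sumr_const card_ord; apply: le_trans.
have mE : m = #|~: S|%:R.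
  by rewrite /m -[X in X%:R - _](card_ord n) -(cardsC S) natrD addrAC subrr add0r.
have := sum_pair_class R f (~: S); rewrite -mE -/c => H.
apply: le_trans (lerD (lexx _) H) _.
have -> : n%:R * (n%:R - 1) = \sum_(u < n) \sum_(v < n) (u != v)%:R :> R.
  have row (u : 'I_n) : \sum_(v < n) (u != v)%:R = n%:R - 1 :> R.
    rewrite -[X in X%:R - _](card_ord n) -sum1_card natr_sum [in RHS](bigD1 u) //=.
    rewrite addrAC subrr add0r [RHS]big_mkcond; apply: eq_bigr => v _.
    by rewrite eq_sym; case: (v == u).
  by rewrite (eq_bigr _ (fun u _ => row u)) sumr_const card_ord mulr_natl.
rewrite -big_split /=; apply: ler_sum => u _; rewrite -big_split /=; apply: ler_sum => v _.
rewrite !mulr1; apply: le_trans (distmx_ge _ _ _ _).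
have [<-|uv] := eqVneq u v; first by rewrite eqxx !andbF mul0r addr0.
rewrite mul1r lerD2l ler_nat; case: (boolP (e u v)) => [euv|_]; last exact: leq_b1.
rewrite !inE; case: (boolP (u \in S)) => // uS; case: (boolP (v \in S)) => // vS.
by rewrite (sep u v) ?eqxx.
Qed.

(** * Components of G - S as labels of vertices *)

Section VertexCuts.
Variables (n : nat) (e : rel 'I_n) (S : {set 'I_n}).
Hypothesis e_simple : simple_graph e.
Local Notation comp := (fingraph.root (del_rel e S)).

Lemma del_connect_sym : connect_sym (del_rel e S).
Proof.
apply: sym_connect_sym => u v; rewrite /del_rel (e_simple.1 u v).
by case: (u \in S); case: (v \in S).
Qed.

Lemma root_sep (u v : 'I_n) : u \notin S -> v \notin S -> e u v -> comp u = comp v.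
Proof.
move=> uS vS euv; apply/eqP; rewrite (root_connect del_connect_sym).
by apply: connect1; rewrite /del_rel uS vS.
Qed.

Lemma ncomp_le_card_roots : (ncomp e S <= #|comp @: ~: S|)%N.
Proof.
rewrite /ncomp /n_comp_mem; apply: subset_leq_card; apply/subsetP => u.
by rewrite !inE /= => /andP[/eqP ru uS]; apply/imsetP; exists u; rewrite ?inE.
Qed.

Lemma card_roots_le : (#|S| + #|comp @: ~: S| <= n)%N.
Proof.
have := cardsC S; rewrite card_ord => cardS.
by rewrite -[X in (_ <= X)%N]cardS leq_add2l leq_imset_card.
Qed.

(** For empty [S] nothing is deleted, so connectedness puts all roots into one singleton. *)
Lemma vertex_cut_nonempty : connected_graph e -> (1 < #|comp @: ~: S|)%N -> (0 < #|S|)%N.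
Proof.
move=> e_conn; rewrite card_gt0; apply: contraTneq => S0.
have del_e : del_rel e S =2 e by move=> u v; rewrite /del_rel S0 !inE.
rewrite -leqNgt; have [->|/set0Pn[u _]] := eqVneq (~: S) set0; first by rewrite imset0 cards0.
rewrite -(cards1 (comp u)); apply: subset_leq_card; apply/subsetP => _ /imsetP[v _ ->].
by rewrite inE (root_connect del_connect_sym) (eq_connect del_e) e_conn.
Qed.

End VertexCuts.

(** * The two cases, by the size of the cut *)

(** A separating labelling remains separating when [S] grows, so [S] can be enlarged to size [q]
    with the same [f]; the components need not be recomputed. *)
Lemma few_removed_iso (R : realType) (n q p k : nat) (e : rel 'I_n) (S : {set 'I_n})
    (f : 'I_n -> 'I_n) (l1 l2 : R) :
  n = (q + p + k)%N -> (0 < q)%N -> (0 < p)%N -> (0 < k)%N -> simple_graph e ->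
  (forall u v, u \notin S -> v \notin S -> e u v -> f u = f v) ->
  (#|S| <= q)%N -> (k < #|f @: ~: S|)%N ->
  largest_eig (distmx R e) l1 -> largest_eig (distmx R (join_graph n q p)) l2 -> l1 <= l2 ->
  graph_iso e (join_graph n q p).
Proof.
move=> nE q_gt0 p_gt0 k_gt0 e_simple sep Sq kf l1_max l2_max l12; subst n.
have [|S' [SS' cardS' kf']] := @enlarge_keep_labels _ k.+1 q _ f S Sq _ kf; first by lia.
apply: (@join_graph_minimal R q p k e S' f l1 l2) => //; last by case: l1_max.
move=> u v uS vS; apply: sep; first by apply: contra uS; exact: (subsetP SS').
by apply: contra vS; exact: (subsetP SS').
Qed.

Lemma many_components_eig_gt (R : realType) (n q p k : nat) (e : rel 'I_n) (S : {set 'I_n})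
    (f : 'I_n -> 'I_n) (l1 l2 x b : R) :
  n = (q + p + k)%N -> (0 < q)%N -> (0 < p)%N -> (0 < k)%N -> simple_graph e ->
  (forall u v, u \notin S -> v \notin S -> e u v -> f u = f v) ->
  largest_eig (distmx R e) l1 -> largest_eig (distmx R (join_graph n q p)) l2 ->
  0 <= b -> p%:R * b + k%:R < x -> 3 * k%:R < x + (q%:R + k%:R + x) * b ->
  x * n%:R <= (#|f @: ~: S|%:R - 1) * (2 * (n%:R - #|S|%:R) - #|f @: ~: S|%:R) ->
  l2 < l1.
Proof.
move=> nE q_gt0 p_gt0 k_gt0 [sym_e _] sep [_ l1_max] l2_max b_ge0 xb1 xb2 many.
have n_gt0 : (0 : R) < n%:R by rewrite ltr0n; lia.
have l1_ge : n%:R - 1 + x <= l1.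
  rewrite -(ler_pM2r n_gt0); have := distmx_eig_lower sym_e sep l1_max.
  have -> : (n%:R - 1 + x) * n%:R = n%:R * (n%:R - 1) + x * n%:R :> R by ring.
  by lra.
suff : l2 + 1 < n%:R + x by lra.
clear l1_ge many l1_max sep; subst n.
have [al [be [ga [[al0 be0 ga0] [Eal Ebe Ega _]]]]] := join_eigenvector q_gt0 p_gt0 k_gt0 l2_max.
rewrite !natrD; apply: (@join_eig_upper _ q%:R p%:R k%:R b x (l2 + 1) al be ga) => //;
  rewrite ?ltr0n //.
by rewrite -addrA.
Qed.

(** * Numerical estimates for the two parts *)

Lemma tough_count_integer (R : realFieldType) (N T s c : R) :
  1 <= T -> 4 * T ^+ 2 + 10 * T <= N -> s + 1 <= T * c -> 3 <= c -> s + c <= N ->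
  3 * N <= (c - 1) * (2 * (N - s) - c).
Proof.
move=> T1 TN sTc c3 scN.
(* Two upper bounds on [s] compete, [T * c - 1] and [N - c]; the sharper one is used on each side of
   the point where they meet. *)
have [cN|cN] := lerP ((T + 1) * c) (N + 1).
  apply: le_trans (_ : (c - 1) * (2 * (N - (T * c - 1)) - c) <= _); last first.
    by rewrite ler_wpM2l; lra.
  have lin : (2 * T + 1) * (c + 2) <= 2 * N + 2.
    rewrite -(ler_pM2l (_ : 0 < T + 1)); last lra.
    apply: le_trans (_ : (2 * T + 1) * ((N + 1) + 2 * (T + 1)) <= _); last by nra.
    have -> : (T + 1) * ((2 * T + 1) * (c + 2)) = (2 * T + 1) * ((T + 1) * c + 2 * (T + 1)) by ring.
    by rewrite ler_wpM2l; lra.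
  rewrite -subr_ge0.
  have -> : (c - 1) * (2 * (N - (T * c - 1)) - c) - 3 * N =
      (c - 3) * (2 * N + 2 - (2 * T + 1) * (c + 2)) + (N - 12 * T - 2) by ring.
  by rewrite addr_ge0 ?mulr_ge0 //; nra.
apply: le_trans (_ : (c - 1) * c <= _); last by rewrite ler_wpM2l; lra.
rewrite -(ler_pM2l (_ : 0 < (T + 1) ^+ 2)); last by nra.
have -> : (T + 1) ^+ 2 * ((c - 1) * c) = ((T + 1) * c - (T + 1)) * ((T + 1) * c) by ring.
apply: le_trans (_ : (N - T) * (N + 1) <= _); last by apply: ler_pM; nra.
have : 0 <= N * (N - 3 * T ^+ 2 - 7 * T - 2) - T by nra.
nra.
Qed.

(** In the given range the right side is smallest at [c = K * s + 1]. It is then a concave quadratic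
    in [s], whose difference from its value at [s = 2] factors; that value is the left side. *)
Lemma tough_count_unit_fraction (R : realFieldType) (N K s c : R) :
  1 <= K -> 9 * K ^+ 2 + 9 * K + 4 <= 2 * K * N -> K * s + 1 <= c -> 2 <= s -> s + c <= N ->
  2 * K * (2 * N - 2 * K - 5) <= (c - 1) * (2 * (N - s) - c).
Proof.
move=> K1 KN Ksc s2 scN.
apply: le_trans (_ : K * s * (2 * (N - s) - (K * s + 1)) <= _); last first.
  rewrite -subr_ge0.
  have -> : (c - 1) * (2 * (N - s) - c) - K * s * (2 * (N - s) - (K * s + 1)) =
    (c - (K * s + 1)) * (2 * (N - s) + 1 - c - (K * s + 1)) by ring.
  by rewrite mulr_ge0 //; lra.
have lin : (K + 2) * (s + 2) <= 2 * N - 1.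
  rewrite -(ler_pM2l (_ : 0 < K + 1)); last lra.
  have -> : (K + 1) * ((K + 2) * (s + 2)) = (K + 2) * ((K * s + s) + 2 * (K + 1)) by ring.
  apply: le_trans (_ : (K + 2) * ((N - 1) + 2 * (K + 1)) <= _); last by nra.
  by rewrite ler_wpM2l; lra.
rewrite -subr_ge0.
have -> : K * s * (2 * (N - s) - (K * s + 1)) - 2 * K * (2 * N - 2 * K - 5) =
  K * ((s - 2) * (2 * N - 1 - (K + 2) * (s + 2))) by ring.
by rewrite !mulr_ge0 //; lra.
Qed.

Theorem theorem1p2 (R : realType) :
  (forall (t n : nat) (e : rel 'I_n),
     (0 < t)%N -> (4 * t ^ 2 + 10 * t <= n)%N ->
     simple_graph e -> connected_graph e ->
     forall l1 l2 : R,
       largest_eig (distmx R e) l1 ->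
       largest_eig (distmx R (join_graph n (2 * t - 1)%N (n - 2 * t)%N)) l2 ->
       l1 <= l2 ->
       ~ graph_iso e (join_graph n (2 * t - 1)%N (n - 2 * t)%N) ->
       tough (t%:R : R) e)
  /\
  (forall (k n : nat) (e : rel 'I_n),
     (0 < k)%N ->
     2 * (k%:R)^-1 + 9 / (2 * (k%:R)^-1) + 9 / 2 <= (n%:R : R) ->
     simple_graph e -> connected_graph e ->
     forall l1 l2 : R,
       largest_eig (distmx R e) l1 ->
       largest_eig (distmx R (join_graph n 1%N (n - 1 - k)%N)) l2 ->
       l1 <= l2 ->
       ~ graph_iso e (join_graph n 1%N (n - 1 - k)%N) ->
       tough ((k%:R)^-1 : R) e).
Proof.
split.
- move=> t n e t_gt0 n_ge e_simple _ l1 l2 l1_max l2_max l12 not_iso S cut.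
  rewrite -natrM ler_nat leqNgt; apply/negP => not_tough; apply: not_iso.
  have sep := root_sep e_simple (S := S).
  have le_c := ncomp_le_card_roots e S; have c_le := card_roots_le e S.
  set c := #|_| in le_c c_le.
  have c_ge2 : (1 < c)%N by exact: leq_trans cut le_c.
  have sTc : (#|S| < t * c)%N by apply: leq_trans not_tough _; rewrite leq_mul2l le_c orbT.
  have n_ge' : (4 * (t * t) + 10 * t <= n)%N by rewrite mulnn.
  have tt : (t <= t * t)%N by rewrite leq_pmull.
  have nE : n = (2 * t - 1 + (n - 2 * t) + 1)%N by lia.
  have [Sq|Sq] := leqP #|S| (2 * t - 1).
    by apply: (few_removed_iso nE _ _ _ e_simple sep Sq c_ge2 l1_max l2_max l12); lia.
  (* Here [2 * t <= #|S| < t * c]. *)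
  have c_ge3 : (2 < c)%N by nia.
  have q_gt0N : (0 < 2 * t - 1)%N by lia.
  have p_gt0N : (0 < n - 2 * t)%N by lia.
  have p_gt0 : (0 : R) < (n - 2 * t)%:R by rewrite ltr0n.
  suff : l2 < l1 by rewrite ltNge l12.
  (* With [k = 1] and [x = 3], the choice [b = 1 / p] makes the first condition 2 < 3, and any
     positive [b] gives the second. *)
  apply: (@many_components_eig_gt R _ _ _ _ e S _ l1 l2 3 (n - 2 * t)%:R^-1 nE _ _ _ e_simple sep)
    => //.
  + by rewrite invr_ge0 ltW.
  + by rewrite divff ?gt_eqF //; lra.
  + by rewrite mulr1 ltrDl mulr_gt0 ?invr_gt0 // ltr_wpDl ?addr_ge0 ?ler0n.
  + apply: (@tough_count_integer _ _ t%:R); rewrite ?ler1n // -?natrX -?natrM -?natrD ?ler_nat //.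
    by rewrite natr1 ler_nat.
- move=> k n e k_gt0 n_ge e_simple e_conn l1 l2 l1_max l2_max l12 not_iso S cut.
  have K_gt0 : (0 : R) < k%:R by rewrite ltr0n.
  have K1 : (1 : R) <= k%:R by rewrite ler1n.
  (* The bound on [n] with denominators cleared; [k] stands for 1/t. *)
  have KN : 9 * k%:R ^+ 2 + 9 * k%:R + 4 <= 2 * k%:R * n%:R :> R.
    have := ler_wpM2l (_ : 0 <= 2 * k%:R) n_ge.
    have -> : 2 * k%:R * (2 * k%:R^-1 + 9 / (2 * k%:R^-1) + 9 / 2) =
      9 * k%:R ^+ 2 + 9 * k%:R + 4 :> R by field; rewrite gt_eqF.
    by apply; rewrite mulr_ge0 // ltW.
  have KN' : (9 * (k * k) + 9 * k + 4 <= 2 * k * n)%N.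
    by move: KN; rewrite expr2 -!natrM -!natrD ler_nat.
  rewrite ler_pdivrMl // -natrM ler_nat leqNgt; apply/negP => not_tough; apply: not_iso.
  have sep := root_sep e_simple (S := S).
  have le_c := ncomp_le_card_roots e S; have c_le := card_roots_le e S.
  set c := #|_| in le_c c_le.
  have c_ge2 : (1 < c)%N by exact: leq_trans cut le_c.
  have S_gt0 : (0 < #|S|)%N by exact: (vertex_cut_nonempty e_simple e_conn c_ge2).
  have kSc : (k * #|S| < c)%N by exact: leq_trans not_tough le_c.
  have n_gt : (4 * k + 4 < n)%N by nia.
  have nE : n = (1 + (n - 1 - k) + k)%N by lia.
  have [Sq|Sq] := leqP #|S| 1.
    have kc : (k < c)%N by nia.
    by apply: (few_removed_iso nE _ _ _ e_simple sep Sq kc l1_max l2_max l12); lia.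
  suff : l2 < l1 by rewrite ltNge l12.
  have many : 2 * k%:R * (2 * n%:R - 2 * k%:R - 5) <= (c%:R - 1) * (2 * (n%:R - #|S|%:R) - c%:R) :> R.
    apply: tough_count_unit_fraction => //.
    * by rewrite -natrM natr1 ler_nat.
    * by rewrite ler_nat.
    * by rewrite -natrD ler_nat.
  have p_gt0N : (0 < n - 1 - k)%N by lia.
  have p_gt0 : (0 : R) < (n - 1 - k)%:R by rewrite ltr0n.
  have pE : (n - 1 - k)%:R = n%:R - 1 - k%:R :> R.
    by rewrite [in RHS]nE !natrD; ring.
  (* The count [many] allows [x = 3 * k] exactly when [n >= 4 * k + 10]. Below that, [x = 5/2 * k]
     needs only [8 * k + 20 <= 3 * n]; the second condition on [b] then has a deficit of [k / 2],
     made up by the term in [b] because [p] is at most [3 * k + 8]. *)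
  have [n_big|n_small] := leqP (4 * k + 10) n.
  + apply: (@many_components_eig_gt R _ _ _ _ e S _ l1 l2 (3 * k%:R) (k%:R / (n - 1 - k)%:R)
      nE _ _ _ e_simple sep) => //.
    * by rewrite divr_ge0 // ltW.
    * by rewrite mulrC divfK ?gt_eqF //; lra.
    * by rewrite ltrDl mulr_gt0 ?divr_gt0 //; lra.
    * apply: le_trans many; have : 4 * k%:R + 10 <= n%:R :> R by rewrite -natrM -natrD ler_nat.
      by rewrite -subr_ge0 => /(mulr_ge0 (ltW K_gt0)); lra.
  + apply: (@many_components_eig_gt R _ _ _ _ e S _ l1 l2 (5 / 2 * k%:R)
      (5 / 4 * k%:R / (n - 1 - k)%:R) nE _ _ _ e_simple sep) => //.
    * by rewrite divr_ge0 ?(ltW p_gt0) //; lra.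
    * by rewrite mulrC divfK ?gt_eqF //; lra.
    * have dist (y z w P : R) : (y + z * w) * P = y * P + z * (w * P) by ring.
      rewrite -(ltr_pM2r p_gt0) dist divfK ?gt_eqF // pE.
      have : n%:R + 1 <= 4 * k%:R + 10 :> R by rewrite -natrM -natrD natr1 ler_nat.
      nra.
    * apply: le_trans many; have : 8 * k%:R + 20 <= 3 * n%:R :> R.
        by rewrite -(ler_pM2l K_gt0); nra.
      by rewrite -subr_ge0 => /(mulr_ge0 (ltW K_gt0)); lra.
Qed.
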